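(* Any equation of the form $F(r,s,t)=0$ admits the symmetries $$X_1=\partial_x,\quad X_2=\partial_y,\quad X_3=\partial_z,\quad X_4=x\partial_z,\quad X_5=y\partial_z,\quad X_6=x\partial_x+y\partial_y+2z\partial_z.$$ Let $(\epsilon,m)\in\{\pm1\}\times(0,1]$ and $\alpha=1-\epsilon m^4$. The equation $$rt-s^2-\frac{t^4}{12}=0\qquad(\text{case }(\epsilon,m)=(1,1),\ \alpha=0)$$ and, for $(\epsilon,m)\ne(1,1)$ (so $\alpha\neq0$), the equation $$(\epsilon+m^4)^2(2\alpha s-t^2)^3+\epsilon m^4(3\alpha^2r-6\alpha st+2t^3)^2=0$$ have the following additional symmetries: $$X_7=y\partial_y+3z\partial_z,\quad X_8=x\partial_y-\frac{\alpha}{2}y^2\partial_z,\quad X_9=x^2\partial_x+xy\partial_y+\left(xz-\frac{\alpha}{6}y^3\right)\partial_z.$$ In particular, all of these symmetries are projectable point symmetries.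
   Context: $J^2(\mathbb{R}^2,\mathbb{R})$ has coordinates $(x,y,z,p,q,r,s,t)$ with $p=z_x,q=z_y,r=z_{xx},s=z_{xy},t=z_{yy}$; all considerations are local and smooth. A vector field $X$ on $J^0(\mathbb{R}^2,\mathbb{R})$ (coordinates $(x,y,z)$) has a unique prolongation $X^{(2)}$ to $J^2(\mathbb{R}^2,\mathbb{R})$ preserving the contact system generated by $dz-p\,dx-q\,dy$, $dp-r\,dx-s\,dy$, $dq-s\,dx-t\,dy$. $X$ is a (point) symmetry of $F=0$ if $\mathcal{L}_{X^{(2)}}F=0$ whenever $F=0$. A point symmetry is projectable if it projects to a vector field on the base $\mathbb{R}^2$ with coordinates $(x,y)$. *)

(* Defs.v *)
From Stdlib Require List.
From HB Require Import structures.
From mathcomp Require Import all_boot all_order all_algebra.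
From mathcomp Require Import all_classical all_reals all_analysis.
Set Implicit Arguments.
Unset Strict Implicit.
Unset Printing Implicit Defensive.
Import Order.TTheory GRing.Theory Num.Theory.
Import numFieldNormedType.Exports.
Local Open Scope classical_set_scope.
Local Open Scope ring_scope.

Section Calculus.
Context {R : realType} {n : nat}.
Implicit Types (U : set 'rV[R]_n.+1) (f : 'rV[R]_n.+1 -> R).

Definition partial (i : 'I_n.+1) f : 'rV[R]_n.+1 -> R :=
  fun a => 'D_(delta_mx ord0 i) f a.

(* Meant for open [U]: the derivatives are taken in the whole space. *)
Fixpoint Ck_on (k : nat) U f : Prop :=
  match k with
  | 0 => forall a, U a -> {for a, continuous f}
  | k'.+1 => (forall a, U a -> differentiable f a) /\
             (forall i, Ck_on k' U (partial i f))
  end.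

Definition smooth_on U f : Prop := forall k, Ck_on k U f.

(* Vector fields and 1-forms on R^(n+1) are both given by their components in
   the coordinate (co)frame. *)
Definition vfield : Type := 'rV[R]_n.+1 -> 'rV[R]_n.+1.
Definition oneform : Type := 'rV[R]_n.+1 -> 'rV[R]_n.+1.

Definition smooth_vfield (X : vfield) : Prop :=
  forall i, smooth_on setT (fun a => X a ord0 i).

Definition lie_fun (X : vfield) f : 'rV[R]_n.+1 -> R := fun a => 'D_(X a) f a.

(* (L_X w)_k = \sum_i X^i d_i w_k + \sum_i w_i d_k X^i. *)
Definition lie_form (X : vfield) (w : oneform) : oneform := fun a =>
  \row_k (lie_fun X (fun b => w b ord0 k) a
          + \sum_i w a ord0 i * partial k (fun b => X b ord0 i) a).

End Calculus.
Arguments vfield R n : clear implicits.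
Arguments oneform R n : clear implicits.

Section Jets.
Context {R : realType}.

(* Coordinates (x, y) on the base, (x, y, z) on J^0 and
   (x, y, z, p, q, r, s, t) on J^2. *)
Local Notation base := 'rV[R]_2.
Local Notation J0 := 'rV[R]_3.
Local Notation J2 := 'rV[R]_8.

Definition crd {n : nat} (a : 'rV[R]_n.+1) (k : nat) : R := a ord0 (inord k).

Definition pr_base (a : J0) : base := \row_k [:: crd a 0; crd a 1]`_k.

Definition pr_J0 (j : J2) : J0 := \row_k [:: crd j 0; crd j 1; crd j 2]`_k.

Definition rst (j : J2) : 'rV[R]_3 := \row_k [:: crd j 5; crd j 6; crd j 7]`_k.

(* dz - p dx - q dy, dp - r dx - s dy, dq - s dx - t dy. *)
Definition contact_form (i : 'I_3) : oneform R 7 := fun j =>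
  let p := crd j 3 in let q := crd j 4 in
  let r := crd j 5 in let s := crd j 6 in let t := crd j 7 in
  \row_k (nth [::] [:: [:: - p; - q; 1; 0; 0; 0; 0; 0];
                       [:: - r; - s; 0; 1; 0; 0; 0; 0];
                       [:: - s; - t; 0; 0; 1; 0; 0; 0]] i)`_k.

(* The module over the smooth functions generated by the contact forms. *)
Definition contact_system : set (oneform R 7) :=
  [set w | exists2 c : 'I_3 -> J2 -> R,
     forall i, smooth_on setT (c i) &
     forall j, w j = \sum_i c i j *: contact_form i j].

Definition preserves_contact (Y : vfield R 7) : Prop :=
  forall w, contact_system w -> contact_system (lie_form Y w).

(* [Y] is a prolongation to J^2 of the vector field [X] on J^0; since the
   projection J^2 -> J^0 is linear in these coordinates, it is its own
   differential. *)
Definition is_prolongation (X : vfield R 2) (Y : vfield R 7) : Prop :=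
  [/\ smooth_vfield Y,
      forall j, pr_J0 (Y j) = X (pr_J0 j) &
      preserves_contact Y].

(* [X] is a symmetry of the equation [G = 0], where [G] is defined on the open
   subset [W] of J^2. *)
Definition point_symmetry (W : set J2) (G : J2 -> R) (X : vfield R 2) : Prop :=
  smooth_vfield X /\
  exists Y : vfield R 7,
    unique (is_prolongation X) Y /\
    forall j, W j -> G j = 0 -> lie_fun Y G j = 0.

(* As above, the projection J^0 -> R^2 is its own differential. *)
Definition projectable (X : vfield R 2) : Prop :=
  exists2 Z : vfield R 1,
    smooth_vfield Z & forall a, pr_base (X a) = Z (pr_base a).

(* [X] is a projectable point symmetry of the equation [F(r, s, t) = 0], where
   [F] is defined on the open subset [U] of R^3. *)
Definition projectable_symmetry (U : set 'rV[R]_3) (F : 'rV[R]_3 -> R)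
    (X : vfield R 2) : Prop :=
  point_symmetry (rst @^-1` U) (F \o rst) X /\ projectable X.

Definition mkfield (xi eta phi : R -> R -> R -> R) : vfield R 2 := fun a =>
  let x := crd a 0 in let y := crd a 1 in let z := crd a 2 in
  \row_k [:: xi x y z; eta x y z; phi x y z]`_k.

Definition X1 := mkfield (fun x y z => 1) (fun x y z => 0) (fun x y z => 0).
Definition X2 := mkfield (fun x y z => 0) (fun x y z => 1) (fun x y z => 0).
Definition X3 := mkfield (fun x y z => 0) (fun x y z => 0) (fun x y z => 1).
Definition X4 := mkfield (fun x y z => 0) (fun x y z => 0) (fun x y z => x).
Definition X5 := mkfield (fun x y z => 0) (fun x y z => 0) (fun x y z => y).
Definition X6 :=
  mkfield (fun x y z => x) (fun x y z => y) (fun x y z => 2 * z).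
Definition X7 :=
  mkfield (fun x y z => 0) (fun x y z => y) (fun x y z => 3 * z).
Definition X8 (alpha : R) :=
  mkfield (fun x y z => 0) (fun x y z => x)
          (fun x y z => - (alpha / 2 * y ^+ 2)).
Definition X9 (alpha : R) :=
  mkfield (fun x y z => x ^+ 2) (fun x y z => x * y)
          (fun x y z => x * z - alpha / 6 * y ^+ 3).

Definition F_special (h : 'rV[R]_3) : R :=
  let r := crd h 0 in let s := crd h 1 in let t := crd h 2 in
  r * t - s ^+ 2 - t ^+ 4 / 12.

Definition F_generic (eps m alpha : R) (h : 'rV[R]_3) : R :=
  let r := crd h 0 in let s := crd h 1 in let t := crd h 2 in
  (eps + m ^+ 4) ^+ 2 * (2 * alpha * s - t ^+ 2) ^+ 3
  + eps * m ^+ 4 * (3 * alpha ^+ 2 * r - 6 * alpha * s * t + 2 * t ^+ 3) ^+ 2.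

End Jets.

(* Main.v *)
(* Writing the contact forms as du - u_x dx - u_y dy with u = z, p, q, a field Y
   on J^2 preserves the contact system iff each [Y^{u_x}], [Y^{u_y}] is given by
   the usual total-derivative formula in terms of [Y^x], [Y^y], [Y^u], and
   dY^u - u_x dY^x - u_y dY^y has no dr, ds, dt components.  The formulas give
   uniqueness of prolongations.  For existence, all nine fields lie in one
   polynomial family whose prolongation is explicit.  The prolongations of
   X1, ..., X6 do not move r, s, t; if F is the left-hand side of either special
   equation, of weight k = 4 or 6 in (r, s, t) with weights (3, 2, 1), then X7,
   X8, X9 map F to k F, 0, - k x F. *)
Require Import Defs.
From Stdlib Require List.
From HB Require Import structures.
From mathcomp Require Import all_boot all_order all_algebra.
From mathcomp Require Import all_classical all_reals all_analysis.
From mathcomp Require Import ring lra.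
Import Order.TTheory GRing.Theory Num.Theory.
Import numFieldNormedType.Exports.
Local Open Scope classical_set_scope.
Local Open Scope ring_scope.

(** * Directional derivatives of polynomials in the coordinates *)

Section Coordinates.
Context {R : realType} {n : nat}.
Implicit Types (a v : 'rV[R]_n.+1) (f g : 'rV[R]_n.+1 -> R).

Lemma crd_row (s : seq R) k :
  (k < n.+1)%N -> crd (\row_(i < n.+1) s`_i) k = s`_k.
Proof. by move=> kn; rewrite /crd mxE inordK. Qed.

Lemma crd_delta k l : (k < n.+1)%N -> (l < n.+1)%N ->
  crd (delta_mx ord0 (inord l) : 'rV[R]_n.+1) k = (k == l)%:R.
Proof. by move=> kn ln; rewrite /crd mxE eqxx -val_eqE /= !inordK. Qed.

Lemma is_derive_crd a v k : is_derive a v (crd ^~ k) (crd v k).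
Proof.
have d : differentiable (crd ^~ k) a by exact: differentiable_coord.
apply: DeriveDef; first exact: diff_derivable.
rewrite /derive; apply: cvg_lim => //; apply: cvg_near_cst.
(* By linearity the quotient equals [crd v k] as soon as [h] is nonzero, which the punctured
   neighbourhood provides. *)
near=> h; rewrite /crd /= !mxE addrK scalerA mulVf ?scale1r//.
by near: h; exact: nbhs_dnbhs_neq.
Unshelve. all: by end_near. Qed.

(** This and the next rules are stated for pointwise expressions, so that they apply directly to a
    function written as a polynomial in [crd b k]. *)
Lemma is_derive_addf a v f g df dg :
  is_derive a v f df -> is_derive a v g dg ->
  is_derive a v (fun b => f b + g b) (df + dg).
Proof. exact: is_deriveD. Qed.

Lemma is_derive_oppf a v f df :
  is_derive a v f df -> is_derive a v (fun b => - f b) (- df).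
Proof. exact: is_deriveN. Qed.

Lemma is_derive_mulf a v f g df dg :
  is_derive a v f df -> is_derive a v g dg ->
  is_derive a v (fun b => f b * g b) (f a * dg + g a * df).
Proof. exact: is_deriveM. Qed.

Lemma is_derive_expf a v f m df : is_derive a v f df ->
  is_derive a v (fun b => f b ^+ m.+1) (m.+1%:R * f a ^+ m * df).
Proof.
move=> fd; elim: m => [|m IH]; first by rewrite !mul1r.
rewrite (_ : (fun _ => _) = fun b => f b * f b ^+ m.+1); last first.
  by apply/funext => b; rewrite exprS.
have := is_derive_mulf a v f _ _ _ fd IH.
by congr is_derive; rewrite exprS; ring.
Qed.

End Coordinates.

(** The derivative is left as an existential variable that the rules fill in; what remains is an
    algebraic identity between it and the claimed value. *)
Ltac derive_poly :=
  notypeclasses refine (@is_derive_eq _ _ _ _ _ _ _ _ _ _);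
  [ repeat first [ apply is_derive_cst | apply is_derive_crd
                 | apply is_derive_addf | apply is_derive_oppf
                 | apply is_derive_expf | apply is_derive_mulf ] | ].

(** * Closure properties of smooth functions, and the Lie derivative in coordinates *)

Section Smooth.
Context {R : realType} {n : nat}.
Implicit Types (f g : 'rV[R]_n.+1 -> R).

Lemma CkW k f : Ck_on k.+1 setT f -> Ck_on k setT f.
Proof.
elim: k f => [|k IH] f [fd fp].
  by move=> a aT; exact: (differentiable_continuous (fd a aT)).
by split=> // i; exact: IH.
Qed.

Lemma CkD k f g :
  Ck_on k setT f -> Ck_on k setT g -> Ck_on k setT (fun a => f a + g a).
Proof.
elim: k f g => [|k IH] f g.
  by move=> fc gc a aT; apply: continuousD; [exact: fc|exact: gc].
move=> [fd fp] [gd gp]; split=> [a aT|i].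
  by apply: differentiableD; [exact: fd|exact: gd].
rewrite (_ : partial i _ = fun a => partial i f a + partial i g a).
  exact: (IH _ _ (fp i) (gp i)).
apply/funext => a; rewrite /partial deriveD//.
- exact/diff_derivable/(fd a).
- exact/diff_derivable/(gd a).
Qed.

(** In the product rule one factor stays undifferentiated and is still of class [k.+1]; [CkW] lowers
    it to the class [k] of the induction hypothesis. *)
Lemma CkM k f g :
  Ck_on k setT f -> Ck_on k setT g -> Ck_on k setT (fun a => f a * g a).
Proof.
elim: k f g => [|k IH] f g.
  by move=> fc gc a aT; apply: continuousM; [exact: fc|exact: gc].
move=> fk gk; have [fd fp] := fk; have [gd gp] := gk; split=> [a aT|i].
  by apply: differentiableM; [exact: fd|exact: gd].
rewrite (_ : partial i _ = fun a => f a * partial i g a + g a * partial i f a).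
  by apply: CkD; apply: IH; do ?[exact: CkW|exact: fp|exact: gp].
apply/funext => a; rewrite /partial deriveM//.
- exact/diff_derivable/(fd a).
- exact/diff_derivable/(gd a).
Qed.

Lemma smoothD f g : smooth_on setT f -> smooth_on setT g ->
  smooth_on setT (fun a => f a + g a).
Proof. by move=> fs gs k; exact: CkD. Qed.

Lemma smoothM f g : smooth_on setT f -> smooth_on setT g ->
  smooth_on setT (fun a => f a * g a).
Proof. by move=> fs gs k; exact: CkM. Qed.

Lemma smooth_cst (c : R) : smooth_on setT (fun _ : 'rV[R]_n.+1 => c).
Proof.
move=> k; elim: k c => [|k IH] c.
  by move=> a _; exact: (@cst_continuous _ _ c a).
split=> [a _|i]; first exact: differentiable_cst.
rewrite (_ : partial i _ = fun=> 0) //.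
by apply/funext => a; rewrite /partial derive_cst.
Qed.

Lemma smooth_crd l : smooth_on setT (fun a : 'rV[R]_n.+1 => crd a l).
Proof.
case=> [|k]; first by move=> a _; exact: coord_continuous.
split=> [a _|i]; first exact: differentiable_coord.
rewrite (_ : partial i _ = fun=> crd (delta_mx ord0 i) l).
  exact: smooth_cst.
apply/funext => a; rewrite /partial.
by have -> := @derive_val _ _ _ _ _ _ _ (is_derive_crd a (delta_mx ord0 i) l).
Qed.

Lemma smoothN f : smooth_on setT f -> smooth_on setT (fun a => - f a).
Proof.
move=> fs; rewrite (_ : (fun _ => _) = fun a => -1 * f a).
  exact/smoothM/fs/smooth_cst.
by apply/funext => a; rewrite mulN1r.
Qed.

Lemma smoothX f m : smooth_on setT f -> smooth_on setT (fun a => f a ^+ m).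
Proof.
move=> fs; elim: m => [|m IH]; first exact: smooth_cst.
rewrite (_ : (fun _ => _) = fun a => f a * f a ^+ m); first exact: smoothM.
by apply/funext => a; rewrite exprS.
Qed.

Lemma smooth_sum m (f : 'I_m -> 'rV[R]_n.+1 -> R) :
  (forall i, smooth_on setT (f i)) -> smooth_on setT (fun a => \sum_i f i a).
Proof.
elim: m f => [|m IH] f fs.
  rewrite (_ : (fun _ => _) = fun=> 0); first exact: smooth_cst.
  by apply/funext => a; rewrite big_ord0.
rewrite (_ : (fun _ => _) =
    fun a => f ord0 a + \sum_i f (lift ord0 i) a); first exact/smoothD/IH.
by apply/funext => a; rewrite big_ord_recl.
Qed.

Lemma smooth_partial f i : smooth_on setT f -> smooth_on setT (partial i f).
Proof. by move=> fs k; have [_ /(_ i)] := fs k.+1. Qed.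

Lemma smooth_differentiable f a : smooth_on setT f -> differentiable f a.
Proof. by move=> fs; have [+ _] := fs 1%N; exact. Qed.

Lemma smooth_derivable f a v : smooth_on setT f -> derivable f a v.
Proof. by move=> fs; exact/diff_derivable/smooth_differentiable. Qed.

(** The differential is linear in the direction, so [X a] may be expanded in the standard basis.
    This turns smoothness of a Lie derivative into smoothness of sums and products. *)
Lemma lie_funE (X : vfield R n) f a : smooth_on setT f ->
  lie_fun X f a = \sum_i X a ord0 i * partial i f a.
Proof.
move=> fs; have fd := smooth_differentiable f a fs.
rewrite /lie_fun deriveE// [in LHS](row_sum_delta (X a)) linear_sum.
by apply: eq_bigr => i _; rewrite linearZ /partial deriveE.
Qed.

Lemma smooth_lie_fun (X : vfield R n) f :
  smooth_vfield X -> smooth_on setT f -> smooth_on setT (lie_fun X f).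
Proof.
move=> Xs fs; rewrite (_ : lie_fun X f =
    fun a => \sum_i X a ord0 i * partial i f a).
  by apply: smooth_sum => i; apply: smoothM; [exact: Xs|exact: smooth_partial].
by apply/funext => a; exact: lie_funE.
Qed.

End Smooth.

Ltac smooth_poly :=
  repeat first [ apply smooth_cst | apply smooth_crd | apply smoothD
               | apply smoothN | apply smoothX | apply smoothM ].

(** * Lie derivatives of the contact forms and of their combinations *)

Section Contact.
Context {R : realType}.
Local Notation J0 := 'rV[R]_3.
Local Notation J2 := 'rV[R]_8.
Implicit Types (Y : vfield R 7) (X : vfield R 2) (j : J2).

(* The [i]-th contact form is [du - u_x dx - u_y dy] for [u = z, p, q]; the next
   three definitions are the indices of the coordinates [u], [u_x] and [u_y]. *)
Definition ju (i : 'I_3) : nat := (i + 2)%N.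
Definition jx (i : 'I_3) : nat := nth 0%N [:: 3; 5; 6]%N i.
Definition jy (i : 'I_3) : nat := nth 0%N [:: 4; 6; 7]%N i.

Lemma contact_formE i j (k : 'I_8) : contact_form i j ord0 k =
  (k == ju i :> nat)%:R - crd j (jx i) * (k == 0 :> nat)%:R
                        - crd j (jy i) * (k == 1 :> nat)%:R.
Proof.
by rewrite mxE; case: i => [[|[|[|//]]] ?];
  case: k => [[|[|[|[|[|[|[|[|//]]]]]]]] ?] /=;
  rewrite /= ?mulr0 ?mulr1 ?subr0 ?sub0r.
Qed.

Lemma smooth_contact_form i (k : 'I_8) :
  smooth_on setT (fun j => contact_form i j ord0 k).
Proof.
under eq_fun do rewrite contact_formE.
by smooth_poly.
Qed.

(* The coefficient of the [k]-th coordinate differential in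
   [dY^u - u_x dY^x - u_y dY^y]. *)
Definition lie_coef Y (i : 'I_3) (k : nat) j : R :=
  partial (inord k) (fun b => crd (Y b) (ju i)) j
  - crd j (jx i) * partial (inord k) (fun b => crd (Y b) 0) j
  - crd j (jy i) * partial (inord k) (fun b => crd (Y b) 1) j.

(** Lie derivation commutes with [d]: besides dY^u - u_x dY^x - u_y dY^y, the form du - u_x dx - u_y
    dy yields - Y^{u_x} dx - Y^{u_y} dy, from the derivatives of its own coefficients. *)
Lemma lie_contact_form Y i j (k : 'I_8) :
  lie_form Y (contact_form i) j ord0 k =
  lie_coef Y i k j - crd (Y j) (jx i) * (k == 0 :> nat)%:R
                   - crd (Y j) (jy i) * (k == 1 :> nat)%:R.
Proof.
rewrite mxE.
have -> : lie_fun Y (fun b => contact_form i b ord0 k) j =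
    - crd (Y j) (jx i) * (k == 0 :> nat)%:R
    - crd (Y j) (jy i) * (k == 1 :> nat)%:R.
  under eq_fun do rewrite contact_formE.
  by apply: derive_val; derive_poly; ring.
(* Only the components of [Y] along u, x and y meet a nonzero coefficient of the form, so the sum
   collapses. *)
rewrite (_ : \sum_(_ < _) _ = lie_coef Y i k j); first by ring.
have sumE (F : 'I_8 -> R) m : (m < 8)%N ->
    \sum_(l < 8) (l == m :> nat)%:R * F l = F (inord m).
  move=> m8; rewrite (bigD1 (inord m)) //= inordK // eqxx mul1r big1 ?addr0//.
  by move=> l; rewrite -val_eqE /= inordK// => /negPf ->; rewrite mul0r.
have i8 : (ju i < 8)%N by case: i => [[|[|[|//]]] ?].
under eq_bigr do rewrite contact_formE !mulrBl -!mulrA.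
rewrite !sumrB -!mulr_sumr (sumE _ _ i8) (sumE _ 0%N)// (sumE _ 1%N)//.
by rewrite /lie_coef inord_val.
Qed.

(** The multipliers are forced by the dz, dp, dq components. The first two hypotheses then match the
    dx and dy components, and the third the dr, ds, dt components, which no contact form has. *)
Lemma lie_contact_form_comb Y i j :
  crd (Y j) (jx i) = lie_coef Y i 0 j
     + \sum_(l < 3) crd j (jx l) * lie_coef Y i (ju l) j ->
  crd (Y j) (jy i) = lie_coef Y i 1 j
     + \sum_(l < 3) crd j (jy l) * lie_coef Y i (ju l) j ->
  (forall k, (4 < k < 8)%N -> lie_coef Y i k j = 0) ->
  lie_form Y (contact_form i) j =
  \sum_(l < 3) lie_coef Y i (ju l) j *: contact_form l j.
Proof.
move=> Ex Ey E0; apply/rowP => k; rewrite lie_contact_form Ex Ey summxE.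
 under [RHS]eq_bigr do rewrite mxE contact_formE.
rewrite !big_ord_recl !big_ord0 /ju /=.
move: (lie_coef Y i) (@crd R 7 j) E0 => L c E0.
have [k4|k4] := ltnP 4 k.
  by rewrite E0 ?k4//; case: k k4 => [[|[|[|[|[|k]]]]] ?] //= _; ring.
by case: k k4 => [[|[|[|[|[|k]]]]] ?] //= _; ring.
Qed.

Lemma contact_form_system i : contact_system (contact_form i : oneform R 7).
Proof.
exists (fun l _ => (l == i)%:R) => [l|j]; first exact: smooth_cst.
rewrite (bigD1 i)//= eqxx scale1r big1 ?addr0// => l /negPf ->.
by rewrite scale0r.
Qed.

(** The sums are the total derivatives along x and y, cut off at the terms in z, p, q. Membership in
    the contact system determines the multipliers, and comparing dx and dy components gives the
    formulas. *)
Lemma total_derivative_formulas Y i j : preserves_contact Y ->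
  crd (Y j) (jx i) = lie_coef Y i 0 j
     + \sum_(l < 3) crd j (jx l) * lie_coef Y i (ju l) j /\
  crd (Y j) (jy i) = lie_coef Y i 1 j
     + \sum_(l < 3) crd j (jy l) * lie_coef Y i (ju l) j.
Proof.
move=> /(_ _ (contact_form_system i))[c _ /(_ j) /rowP E].
have {}E (k : 'I_8) : _ := E k.
(* Among the contact forms only the [l]-th has a component at index [ju l], equal to 1, so this
   component reads off the multiplier. *)
have cE l : lie_coef Y i (ju l) j = c l j.
  have l8 : (ju l < 8)%N by case: l => [[|[|[|//]]] ?].
  have := E (Ordinal l8).
  rewrite lie_contact_form summxE; under eq_bigr do rewrite mxE contact_formE.
  rewrite (bigD1 l)//= big1 => [|m ml].
    by rewrite eqxx /ju !addn2 /= !mulr0 !subr0 mulr1 addr0.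
  have -> : (ju l == ju m)%N = false.
    by rewrite /ju eqn_add2r eq_sym; exact/negbTE.
  by rewrite /ju !addn2 /= !mulr0 !subr0 mulr0.
split; [have := E (Ordinal (isT : (0 < 8)%N))
       |have := E (Ordinal (isT : (1 < 8)%N))];
  rewrite lie_contact_form summxE;
  under eq_bigr do rewrite mxE contact_formE;
  under [X in _ -> _ = _ + X]eq_bigr do rewrite cE;
  rewrite !big_ord_recl !big_ord0 /ju /=;
  move: (lie_coef Y i) (@crd R 7 j) (@crd R 7 (Y j)) => L a b; lra.
Qed.

(** Leibniz rule for the Lie derivative of a combination of the contact forms. *)
Lemma lie_form_comb Y (c : 'I_3 -> J2 -> R) (w : oneform R 7) j :
  (forall i, smooth_on setT (c i)) ->
  (forall a, w a = \sum_i c i a *: contact_form i a) ->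
  lie_form Y w j =
  \sum_i (lie_fun Y (c i) j *: contact_form i j
          + c i j *: lie_form Y (contact_form i) j).
Proof.
move=> cs wE; apply/rowP => k; rewrite !mxE summxE.
have -> : lie_fun Y (fun b => w b ord0 k) j =
    \sum_i (lie_fun Y (c i) j * contact_form i j ord0 k
            + c i j * lie_fun Y (fun b => contact_form i b ord0 k) j).
  rewrite [in LHS](_ : (fun b => _) =
      \sum_i (c i * (fun b => contact_form i b ord0 k))); last first.
    apply/funext => b; rewrite fct_sumE wE summxE.
    by apply: eq_bigr => i _; rewrite mxE.
  rewrite /lie_fun derive_sum; last first.
    move=> i; apply: derivableM; apply: smooth_derivable; first exact: cs.
    exact: smooth_contact_form.
  apply: eq_bigr => i _.
  rewrite deriveM; [|exact/smooth_derivable/cs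
    |exact/smooth_derivable/smooth_contact_form].
  by rewrite /GRing.scale /= addrC [_ * contact_form _ _ _ _]mulrC.
rewrite wE.
under [X in _ + X]eq_bigr do rewrite summxE mulr_suml.
rewrite exchange_big -big_split; apply: eq_bigr => i _.
rewrite !mxE mulrDr addrA; congr (_ + _).
by rewrite mulr_sumr; apply: eq_bigr => l _; rewrite mxE mulrA.
Qed.

(** By the Leibniz rule it suffices to treat the generators; the new multipliers are smooth because
    [lie_coef] is built from partial derivatives of the smooth field [Y]. *)
Lemma preserves_contact_of_forms Y : smooth_vfield Y ->
  (forall i j, lie_form Y (contact_form i) j =
     \sum_(l < 3) lie_coef Y i (ju l) j *: contact_form l j) ->
  preserves_contact Y.
Proof.
move=> Ys YE w [c cs wE].
have Yc k : smooth_on setT (fun j => crd (Y j) k) by exact: Ys.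
exists (fun l j =>
  lie_fun Y (c l) j + \sum_i c i j * lie_coef Y i (ju l) j) => [l|j].
  apply: smoothD; first exact: smooth_lie_fun.
  apply: smooth_sum => i; apply: smoothM => //.
  by do ?apply: smoothD; do ?apply: smoothN; do ?apply: smoothM;
     do ?apply: smooth_partial; do ?exact: smooth_crd; exact: Yc.
rewrite (lie_form_comb Y c)// big_split /=.
under [RHS]eq_bigr do rewrite scalerDl scaler_suml.
rewrite big_split; congr (_ + _); rewrite exchange_big; apply: eq_bigr => i _.
by rewrite YE scaler_sumr; apply: eq_bigr => l _; rewrite scalerA.
Qed.

End Contact.

(** * Uniqueness of the prolongation *)

Section Prolongation.
Context {R : realType}.
Implicit Types (Y : vfield R 7) (X : vfield R 2).

Lemma eq_vfield {n} (Y Y' : vfield R n) :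
  (forall k, (k < n.+1)%N -> forall j, crd (Y j) k = crd (Y' j) k) -> Y = Y'.
Proof.
move=> E; apply/funext => j; apply/rowP => k.
by have := E k (ltn_ord k) j; rewrite /crd inord_val.
Qed.

(** The total-derivative formulas involve partial derivatives of the x, y and u components, so these
    must agree as functions and not only at one point. *)
Lemma preserves_contact_inj Y Y' i :
  preserves_contact Y -> preserves_contact Y' ->
  (forall j, crd (Y j) 0 = crd (Y' j) 0) ->
  (forall j, crd (Y j) 1 = crd (Y' j) 1) ->
  (forall j, crd (Y j) (ju i) = crd (Y' j) (ju i)) ->
  (forall j, crd (Y j) (jx i) = crd (Y' j) (jx i)) /\
  (forall j, crd (Y j) (jy i) = crd (Y' j) (jy i)).
Proof.
move=> cY cY' /funext e0 /funext e1 /funext eu.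
have eL : lie_coef Y i = lie_coef Y' i by rewrite /lie_coef e0 e1 eu.
split=> j.
  by rewrite !(proj1 (total_derivative_formulas _ i j _))// eL.
by rewrite !(proj2 (total_derivative_formulas _ i j _))// eL.
Qed.

Lemma prolongation_unique X Y Y' :
  is_prolongation X Y -> is_prolongation X Y' -> Y = Y'.
Proof.
move=> [_ pY cY] [_ pY' cY'].
have e k : (k < 3)%N -> forall j, crd (Y j) k = crd (Y' j) k.
  move=> k3 j; have : crd (pr_J0 (Y j)) k = crd (pr_J0 (Y' j)) k.
    by rewrite pY pY'.
  by rewrite !crd_row//; case: k k3 => [|[|[|]]].
(* Going up the jet: u = z settles the components at p and q, then u = p those at r and s, and u = q
   the one at t. *)
have step i := preserves_contact_inj Y Y' i cY cY' (e 0%N isT) (e 1%N isT).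
have [e3 e4] := step (@Ordinal 3 0 isT) (e 2%N isT).
have [e5 e6] := step (@Ordinal 3 1 isT) e3.
have [_ e7] := step (@Ordinal 3 2 isT) e4.
by apply: eq_vfield => -[|[|[|[|[|[|[|[|//]]]]]]]] _; do ?exact: e.
Qed.

Lemma smooth_row n (F : 'rV[R]_n.+1 -> seq R) :
  (forall k, (k < n.+1)%N -> smooth_on setT (fun a => (F a)`_k)) ->
  smooth_vfield (fun a => \row_(k < n.+1) (F a)`_k).
Proof. by move=> Fs i; under eq_fun do rewrite mxE; exact: Fs. Qed.

End Prolongation.

(** * A polynomial family of projectable fields and its explicit prolongation *)

Section Family.
Context {R : realType} (a0 a1 a2 b0 b1 b2 c0 c1 c2 c3 d e : R).
Local Notation J2 := 'rV[R]_8.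
Implicit Types j v : J2.

Definition fam : vfield R 2 :=
  mkfield (fun x y z => a0 + a1 * x + a2 * x ^+ 2)
          (fun x y z => b0 + b1 * x + b2 * y + a2 * x * y)
          (fun x y z => c0 + c1 * x + c2 * y + c3 * z + a2 * x * z
                        + d * y ^+ 2 + e * y ^+ 3).

(** The entries after the third come from the total-derivative formulas. In those for r, s, t all
    terms in z, p, q cancel, which suits equations in r, s, t alone. *)
Definition fam2_seq j : seq R :=
  let x := crd j 0 in let y := crd j 1 in let z := crd j 2 in
  let p := crd j 3 in let q := crd j 4 in
  let r := crd j 5 in let s := crd j 6 in let t := crd j 7 in
  [:: a0 + a1 * x + a2 * x ^+ 2;
      b0 + b1 * x + b2 * y + a2 * x * y;
      c0 + c1 * x + c2 * y + c3 * z + a2 * x * z + d * y ^+ 2 + e * y ^+ 3;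
      c1 + (c3 - a1 - a2 * x) * p + a2 * z - (b1 + a2 * y) * q;
      c2 + (c3 - b2) * q + 2 * d * y + 3 * e * y ^+ 2;
      (c3 - 2 * a1 - 3 * a2 * x) * r - 2 * (b1 + a2 * y) * s;
      (c3 - a1 - b2 - 2 * a2 * x) * s - (b1 + a2 * y) * t;
      (c3 - 2 * b2 - a2 * x) * t + 2 * d + 6 * e * y].

Definition fam2 : vfield R 7 := fun j => \row_k (fam2_seq j)`_k.

Lemma crd_fam2 k j : (k < 8)%N -> crd (fam2 j) k = (fam2_seq j)`_k.
Proof. exact: crd_row. Qed.

Lemma smooth_fam2 : smooth_vfield fam2.
Proof.
by apply: smooth_row => -[|[|[|[|[|[|[|[|//]]]]]]]] _ /=; smooth_poly.
Qed.

Lemma smooth_fam : smooth_vfield fam.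
Proof.
by apply: smooth_row => -[|[|[|//]]] _ /=; smooth_poly.
Qed.

Lemma projectable_fam : projectable fam.
Proof.
exists (fun b : 'rV[R]_2 => let x := crd b 0 in let y := crd b 1 in
  \row_k [:: a0 + a1 * x + a2 * x ^+ 2; b0 + b1 * x + b2 * y + a2 * x * y]`_k).
  by apply: smooth_row => -[|[|//]] _ /=; smooth_poly.
by move=> a; apply/rowP => -[[|[|//]] ?]; rewrite !mxE /= !crd_row.
Qed.

Lemma pr_J0_fam2 j : pr_J0 (fam2 j) = fam (pr_J0 j).
Proof.
by apply/rowP => -[[|[|[|//]]] ?]; rewrite !mxE /= !crd_row.
Qed.

(** Only the components at x, y, z, p, q are differentiated in [lie_coef]. The Kronecker symbols
    [dx], ..., [dq] let each identity be read as the differential of a component. *)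
Lemma partial_fam2 k j : (k < 8)%N ->
  let D m := partial (inord k) (fun b => crd (fam2 b) m) j in
  let dx := (0 == k)%:R in let dy := (1 == k)%:R in let dz := (2 == k)%:R in
  let dp := (3 == k)%:R in let dq := (4 == k)%:R in
  let x := crd j 0 in let y := crd j 1 in let z := crd j 2 in
  let p := crd j 3 in let q := crd j 4 in
  [/\ D 0%N = (a1 + 2 * a2 * x) * dx,
      D 1%N = (b1 + a2 * y) * dx + (b2 + a2 * x) * dy,
      D 2%N = (c1 + a2 * z) * dx + (c2 + 2 * d * y + 3 * e * y ^+ 2) * dy
              + (c3 + a2 * x) * dz,
      D 3%N = - a2 * p * dx - a2 * q * dy + a2 * dz
              + (c3 - a1 - a2 * x) * dp - (b1 + a2 * y) * dq &
      D 4%N = (2 * d + 6 * e * y) * dy + (c3 - b2) * dq].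
Proof.
move=> k8 D dx dy dz dp dq x y z p q.
by split; rewrite /D; under eq_fun do rewrite crd_fam2//=;
  apply: derive_val; derive_poly;
  rewrite !crd_delta// /dx /dy /dz /dp /dq /x /y /z /p /q;
  move: (@crd R 7 j) => c; ring.
Qed.

Lemma lie_coef_fam2 i k j : (k < 8)%N ->
  let dx := (0 == k)%:R in let dy := (1 == k)%:R in let dz := (2 == k)%:R in
  let dp := (3 == k)%:R in let dq := (4 == k)%:R in
  let x := crd j 0 in let y := crd j 1 in let z := crd j 2 in
  let p := crd j 3 in let q := crd j 4 in
  lie_coef fam2 i k j =
    [:: (c1 + a2 * z) * dx + (c2 + 2 * d * y + 3 * e * y ^+ 2) * dy
          + (c3 + a2 * x) * dz;
        - a2 * p * dx - a2 * q * dy + a2 * dz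
          + (c3 - a1 - a2 * x) * dp - (b1 + a2 * y) * dq;
        (2 * d + 6 * e * y) * dy + (c3 - b2) * dq]`_i
    - crd j (jx i) * ((a1 + 2 * a2 * x) * dx)
    - crd j (jy i) * ((b1 + a2 * y) * dx + (b2 + a2 * x) * dy).
Proof.
move=> k8 /=; rewrite /lie_coef; have [-> -> D2 D3 D4] := partial_fam2 k j k8.
by case: i => [[|[|[|//]]] ?]; rewrite ?D2 ?D3 ?D4.
Qed.

Lemma fam2_prolongation : is_prolongation fam fam2.
Proof.
split; [exact: smooth_fam2|exact: pr_J0_fam2|].
apply: preserves_contact_of_forms; first exact: smooth_fam2.
move=> i j; apply: lie_contact_form_comb.
- rewrite !big_ord_recl big_ord0 crd_fam2; last by case: i => [[|[|[|//]]] ?].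
  rewrite !lie_coef_fam2//; case: i => [[|[|[|//]]] ?];
  rewrite /= /jx /jy /=; move: (@crd R 7 j) => c; ring.
- rewrite !big_ord_recl big_ord0 crd_fam2; last by case: i => [[|[|[|//]]] ?].
  rewrite !lie_coef_fam2//; case: i => [[|[|[|//]]] ?];
  rewrite /= /jx /jy /=; move: (@crd R 7 j) => c; ring.
(* For the coordinates r, s, t all five Kronecker symbols vanish. *)
- move=> k /andP[k4 k8]; rewrite lie_coef_fam2//.
  case: k k4 k8 => [|[|[|[|[|k]]]]]//= _ _.
  by case: i => [[|[|[|//]]] ?] /=; ring.
Qed.

(** With existence, uniqueness and projectability settled for the whole family, only the tangency of
    [fam2] to the equation is left for each field. *)
Lemma fam_symmetry (U : set 'rV[R]_3) (F : 'rV[R]_3 -> R) :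
  (forall j, U (rst j) -> F (rst j) = 0 -> lie_fun fam2 (F \o rst) j = 0) ->
  projectable_symmetry U F fam.
Proof.
move=> FY; split; last exact: projectable_fam.
split; first exact: smooth_fam.
exists fam2; split; last exact: FY.
split; first exact: fam2_prolongation.
by move=> Y; exact/prolongation_unique/fam2_prolongation.
Qed.

End Family.

(** * Lie derivatives of the equations, and the nine fields as members of the family *)

Section Equations.
Context {R : realType}.
Implicit Types (F : 'rV[R]_3 -> R) (Y : vfield R 7) (j : 'rV[R]_8).

(** Since [rst] is linear, it is constant along the line through [j] in the direction [Y j]; the
    difference quotients of [F \o rst] are all zero. *)
Lemma lie_fun_rst0 Y F j : rst (Y j) = 0 -> lie_fun Y (F \o rst) j = 0.
Proof.
move=> Y0; rewrite /lie_fun /derive; apply: cvg_lim => //.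
apply: cvg_near_cst; near=> h => /=.
suff -> : rst (h *: Y j + j) = rst j by rewrite subrr scaler0.
apply/rowP => k; have /rowP/(_ k) := Y0.
by rewrite !mxE; case: k => [[|[|[|//]]] ?] /=; rewrite /crd !mxE => ->;
  rewrite mulr0 add0r.
Unshelve. all: by end_near. Qed.

Lemma lie_F_special Y j :
  let r := crd j 5 in let s := crd j 6 in let t := crd j 7 in
  lie_fun Y (F_special \o rst) j =
  t * crd (Y j) 5 - 2 * s * crd (Y j) 6 + (r - t ^+ 3 / 3) * crd (Y j) 7.
Proof.
rewrite /= /lie_fun.
rewrite (_ : _ \o _ = fun b : 'rV[R]_8 =>
    crd b 5 * crd b 7 - crd b 6 ^+ 2 - crd b 7 ^+ 4 / 12); last first.
  by apply/funext => b; rewrite /F_special /= !crd_row.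
apply: derive_val; derive_poly.
by move: (@crd R 7 j) (@crd R 7 (Y j)) => c v; field.
Qed.

Lemma lie_F_generic (eps m alpha : R) Y j :
  let r := crd j 5 in let s := crd j 6 in let t := crd j 7 in
  lie_fun Y (F_generic eps m alpha \o rst) j =
  3 * (eps + m ^+ 4) ^+ 2 * (2 * alpha * s - t ^+ 2) ^+ 2
    * (2 * alpha * crd (Y j) 6 - 2 * t * crd (Y j) 7)
  + 2 * eps * m ^+ 4 * (3 * alpha ^+ 2 * r - 6 * alpha * s * t + 2 * t ^+ 3)
    * (3 * alpha ^+ 2 * crd (Y j) 5 - 6 * alpha * t * crd (Y j) 6
       - 6 * alpha * s * crd (Y j) 7 + 6 * t ^+ 2 * crd (Y j) 7).
Proof.
rewrite /= /lie_fun.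
rewrite (_ : _ \o _ = fun b : 'rV[R]_8 =>
    (eps + m ^+ 4) ^+ 2 * (2 * alpha * crd b 6 - crd b 7 ^+ 2) ^+ 3
    + eps * m ^+ 4 * (3 * alpha ^+ 2 * crd b 5 - 6 * alpha * crd b 6 * crd b 7
                      + 2 * crd b 7 ^+ 3) ^+ 2); last first.
  by apply/funext => b; rewrite /F_generic /= !crd_row.
apply: derive_val; derive_poly.
by move: (@crd R 7 j) (@crd R 7 (Y j)) => c v; ring.
Qed.

Lemma eq_mkfield (f g h f' g' h' : R -> R -> R -> R) :
  (forall x y z, f x y z = f' x y z) -> (forall x y z, g x y z = g' x y z) ->
  (forall x y z, h x y z = h' x y z) -> mkfield f g h = mkfield f' g' h'.
Proof.
move=> ff gg hh; apply/funext => a; rewrite /mkfield.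
by rewrite ff gg hh.
Qed.

Lemma X1E : @X1 R = fam 1 0 0 0 0 0 0 0 0 0 0 0.
Proof. by apply: eq_mkfield => x y z; ring. Qed.

Lemma X2E : @X2 R = fam 0 0 0 1 0 0 0 0 0 0 0 0.
Proof. by apply: eq_mkfield => x y z; ring. Qed.

Lemma X3E : @X3 R = fam 0 0 0 0 0 0 1 0 0 0 0 0.
Proof. by apply: eq_mkfield => x y z; ring. Qed.

Lemma X4E : @X4 R = fam 0 0 0 0 0 0 0 1 0 0 0 0.
Proof. by apply: eq_mkfield => x y z; ring. Qed.

Lemma X5E : @X5 R = fam 0 0 0 0 0 0 0 0 1 0 0 0.
Proof. by apply: eq_mkfield => x y z; ring. Qed.

Lemma X6E : @X6 R = fam 0 1 0 0 0 1 0 0 0 2 0 0.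
Proof. by apply: eq_mkfield => x y z; ring. Qed.

Lemma X7E : @X7 R = fam 0 0 0 0 0 1 0 0 0 3 0 0.
Proof. by apply: eq_mkfield => x y z; ring. Qed.

Lemma X8E alpha : @X8 R alpha = fam 0 0 0 0 1 0 0 0 0 0 (- (alpha / 2)) 0.
Proof. by apply: eq_mkfield => x y z; field. Qed.

Lemma X9E alpha : @X9 R alpha = fam 0 0 1 0 0 0 0 0 0 0 0 (- (alpha / 6)).
Proof. by apply: eq_mkfield => x y z; field. Qed.

End Equations.

Theorem proposition7p1 (R : realType) :
  (forall (U : set 'rV[R]_3) (F : 'rV[R]_3 -> R),
     open U -> smooth_on U F ->
     List.Forall (projectable_symmetry U F) [:: X1; X2; X3; X4; X5; X6]) /\
  (forall eps m alpha : R,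
     (eps = 1 \/ eps = -1) -> 0 < m -> m <= 1 -> alpha = 1 - eps * m ^+ 4 ->
     ((eps, m) = (1, 1) ->
        alpha = 0 /\
        List.Forall (projectable_symmetry setT F_special)
                    [:: X7; X8 alpha; X9 alpha]) /\
     ((eps, m) <> (1, 1) ->
        alpha <> 0 /\
        List.Forall (projectable_symmetry setT (F_generic eps m alpha))
                    [:: X7; X8 alpha; X9 alpha])).

Proof.
split=> [U F _ _|eps m alpha eps1 m0 m1 alphaE].
  have zero Y j : crd (Y j) 5 = 0 -> crd (Y j) 6 = 0 -> crd (Y j) 7 = 0 ->
      lie_fun Y (F \o rst) j = 0.
    move=> r0 s0 t0; apply: lie_fun_rst0.
    by apply/rowP => -[[|[|[|//]]] ?]; rewrite !mxE.
  rewrite X1E X2E X3E X4E X5E X6E.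
  (* For [X6] the weight 2 of z cancels against the two derivatives in each of r, s, t. *)
  by repeat (apply List.Forall_nil || apply List.Forall_cons);
    apply: fam_symmetry => j _ _;
    apply: zero; rewrite crd_fam2//=; ring.
have a0 : (eps, m) = (1, 1) -> alpha = 0.
  by case=> e1 m1'; rewrite alphaE e1 m1' expr1n mulr1 subrr.
split=> em; split.
- exact: a0.
(* With [alpha] zero, the prolonged [X8] acts on (r, s, t) by (-2s, -t, 0). *)
- rewrite a0// X7E X8E X9E.
  repeat (apply List.Forall_nil || apply List.Forall_cons);
    apply: fam_symmetry => j _ Fj0;
    rewrite lie_F_special !crd_fam2//=.
  + transitivity (4 * F_special (rst j)); last by rewrite Fj0 mulr0.
    by rewrite /F_special /= !crd_row//=; move: (@crd R 7 j) => c; field.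
  + by move: (@crd R 7 j) => c; field.
  (* On (r, s, t) the prolonged [X9] is -x times that of [X7] plus y times that of [X8], and [X8]
     kills the equation. *)
  + transitivity (- 4 * crd j 0 * F_special (rst j)); last by rewrite Fj0 mulr0.
    by rewrite /F_special /= !crd_row//=; move: (@crd R 7 j) => c; field.
(* For [eps] equal to 1, [alpha] vanishes only if the positive [m] is 1, which is excluded; for
   [eps] equal to -1, [alpha] is 1 + m^4, which is positive. *)
- case: eps1 => eps1; rewrite alphaE eps1.
    apply/eqP; rewrite mul1r subr_eq0 eq_sym pexpr_eq1// ?ltW//.
    by apply/eqP => m1'; apply: em; rewrite eps1 m1'.
  by rewrite mulN1r opprK; apply/eqP; rewrite gt_eqF// ltr_wpDr// exprn_ge0 ?ltW.
- rewrite X7E X8E X9E.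
  repeat (apply List.Forall_nil || apply List.Forall_cons);
    apply: fam_symmetry => j _ Fj0;
    rewrite lie_F_generic !crd_fam2//=.
  + transitivity (6 * F_generic eps m alpha (rst j));
      last by rewrite Fj0 mulr0.
    by rewrite /F_generic /= !crd_row//=; move: (@crd R 7 j) => c; field.
  (* [X8] acts by (-2s, -t, -alpha), which kills both bases 2 alpha s - t^2 and 3 alpha^2 r - 6
     alpha s t + 2 t^3. *)
  + by move: (@crd R 7 j) => c; field.
  (* The same decomposition of [X9] through [X7] and [X8] applies, now with weight 6. *)
  + transitivity (- 6 * crd j 0 * F_generic eps m alpha (rst j));
      last by rewrite Fj0 mulr0.
    by rewrite /F_generic /= !crd_row//=; move: (@crd R 7 j) => c; field.
Qed.
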